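(* For every integer $n\geq 1$, $$X_n=\left[2,\overline{\frac{4}{X_{n-1}-2},\,4}\right]=\left[\overline{\frac{(\eta_n-\eta_{n-1})X_n-1}{\eta_{n-1}},\,\eta_{n-1},\,\frac{(\eta_n-\eta_{n-1})/X_n-1}{\eta_{n-1}}}\right],$$ and all partial quotients appearing here lie in $\mathbb{Z}[X_{n-1}]$.
   Context: For $m\geq 0$ let $X_m=2\cos(2\pi/2^{m+2})$ (so $X_0=0$ and $X_m=\sqrt{2+X_{m-1}}$), viewed as real numbers; $\mathbb{Z}[X_m]$ is the ring of integers of $\mathbb{Q}(X_m)$. For $m\geq 0$ let $\eta_m=1+\sum_{k=1}^{2^m-1}2\cos\left(\frac{k\pi}{2^{m+1}}\right)$ (so $\eta_0=1$). For a sequence $c_0,c_1,\dots$ define $p_k,q_k$ by $\begin{pmatrix}p_k & p_{k-1}\\ q_k & q_{k-1}\end{pmatrix}=\begin{pmatrix}c_0&1\\1&0\end{pmatrix}\cdots\begin{pmatrix}c_k&1\\1&0\end{pmatrix}$; $[c_0,c_1,\dots]$ denotes the real limit of $p_k/q_k$. The notation $[c_0,\overline{c_1,c_2}]$ means the sequence $c_0,c_1,c_2,c_1,c_2,\dots$ and $[\overline{c_1,c_2,c_3}]$ means $c_1,c_2,c_3,c_1,c_2,c_3,\dots$. *)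

(* Defs.v *)
From HB Require Import structures.
From mathcomp Require Import all_boot all_order all_algebra.
From mathcomp Require Import all_classical all_reals all_analysis.

Set Implicit Arguments.
Unset Strict Implicit.
Unset Printing Implicit Defensive.

Import Order.TTheory GRing.Theory Num.Theory.
Import numFieldNormedType.Exports.

Local Open Scope classical_set_scope.
Local Open Scope ring_scope.

Definition Xcos (R : realType) (m : nat) : R :=
  2 * cos (2 * pi / 2 ^+ (m + 2)).

Definition eta_ (R : realType) (m : nat) : R :=
  1 + \sum_(1 <= k < (2 ^ m)%N) 2 * cos (k%:R * pi / 2 ^+ (m + 1)).

(* Z[x], as a subset of the ambient ring *)
Definition int_adjoin (R : realType) (x : R) : set R :=
  [set y | exists f : {poly int}, y = (map_poly intr f).[x]].

Definition cf_step (R : realType) (a : R) : 'M[R]_2 :=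
  \matrix_(i < 2, j < 2) nth 0 (nth [::] [:: [:: a; 1]; [:: 1; 0]] i) j.

(* left-to-right product; its columns are (p_k, q_k) and (p_{k-1}, q_{k-1}) *)
Definition cf_mx (R : realType) (c : nat -> R) (k : nat) : 'M[R]_2 :=
  \prod_(i < k.+1) cf_step (c i).

Definition cf_p (R : realType) (c : nat -> R) (k : nat) : R :=
  cf_mx c k ord0 ord0.

Definition cf_q (R : realType) (c : nat -> R) (k : nat) : R :=
  cf_mx c k ord_max ord0.

(* x = [c_0, c_1, ...].  Partial quotients are arbitrary reals, so some q_k may
   vanish; the first clause keeps the convention y / 0 = 0 out of the limit. *)
Definition cf_value (R : realType) (c : nat -> R) (x : R) : Prop :=
  (\forall k \near \oo, cf_q c k != 0) /\
  (cf_p c k / cf_q c k @[k --> \oo] --> x).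

(* the sequence s followed by t repeated indefinitely (t nonempty) *)
Definition ev_periodic (R : realType) (s t : seq R) (k : nat) : R :=
  if (k < size s)%N then s`_k else t`_((k - size s) %% size t).

(* Main.v *)
(** With [r k = p_k - x q_k], the sequence [r] obeys the same linear recurrence as
    [p] and [q], so when the partial quotients have period [l] it satisfies
    [r (k + l) = mu * r k] as soon as it does so for two consecutive [k].  If
    moreover [|mu| < 1] and the [q_k] stay away from [0], then [p_k / q_k]
    tends to [x].  For the first expansion [mu = (X_n - 2) / (X_n + 2)].  For the
    second, the Dirichlet kernel gives [eta_m = cot (pi / 2^(m+2))], whence
    [eta_n - eta_(n-1) = 1 / sin (pi / 2^(n+1))] and [mu = - 1 / eta_n].
    Integrality comes from [tan t = cot t - 2 cot (2 t)], which makes [eta_m] a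
    unit, and from [(2 - X_m) (2 + X_m) = 2 - X_(m-1)], which makes [2 - X_m]
    and [2 + X_m] divide [2]. *)
Require Import Defs.
From HB Require Import structures.
From mathcomp Require Import all_boot all_order all_algebra.
From mathcomp Require Import all_classical all_reals all_analysis.
From mathcomp Require Import ring lra.

Set Implicit Arguments.
Unset Strict Implicit.
Unset Printing Implicit Defensive.

Import Order.TTheory GRing.Theory Num.Theory.
Import numFieldNormedType.Exports.

Local Open Scope classical_set_scope.
Local Open Scope ring_scope.

(** * Recurrences for convergents *)

Lemma cf_mxS (R : realType) (c : nat -> R) (k : nat) (i : 'I_2) :
  cf_mx c k.+1 i ord0 = cf_mx c k i ord0 * c k.+1 + cf_mx c k i ord_max
  /\ cf_mx c k.+1 i ord_max = cf_mx c k i ord0.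
Proof.
have -> : cf_mx c k.+1 = cf_mx c k *m cf_step (c k.+1).
  by rewrite /cf_mx big_ord_recr.
split; rewrite !mxE !big_ord_recl big_ord0 !mxE /= addr0.
- rewrite mulr1; congr (_ + cf_mx c k i _); exact/val_inj.
- by rewrite mulr1 mulr0 addr0.
Qed.

Lemma cf_mx0 (R : realType) (c : nat -> R) : cf_mx c 0 = cf_step (c 0%N).
Proof. by rewrite /cf_mx big_ord_recl big_ord0 mulr1. Qed.

Lemma cf_p0 (R : realType) (c : nat -> R) : cf_p c 0 = c 0%N.
Proof. by rewrite /cf_p cf_mx0 mxE. Qed.

Lemma cf_q0 (R : realType) (c : nat -> R) : cf_q c 0 = 1.
Proof. by rewrite /cf_q cf_mx0 mxE. Qed.

Lemma cf_p1 (R : realType) (c : nat -> R) : cf_p c 1 = c 0%N * c 1%N + 1.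
Proof. by rewrite /cf_p (cf_mxS c 0 ord0).1 cf_mx0 !mxE. Qed.

Lemma cf_q1 (R : realType) (c : nat -> R) : cf_q c 1 = c 1%N.
Proof. by rewrite /cf_q (cf_mxS c 0 ord_max).1 cf_mx0 !mxE /= mul1r addr0. Qed.

Lemma cf_pSS (R : realType) (c : nat -> R) (k : nat) :
  cf_p c k.+2 = cf_p c k.+1 * c k.+2 + cf_p c k.
Proof. by rewrite /cf_p (cf_mxS c k.+1 ord0).1 (cf_mxS c k ord0).2. Qed.

Lemma cf_qSS (R : realType) (c : nat -> R) (k : nat) :
  cf_q c k.+2 = cf_q c k.+1 * c k.+2 + cf_q c k.
Proof. by rewrite /cf_q (cf_mxS c k.+1 ord_max).1 (cf_mxS c k ord_max).2. Qed.

(** * Convergence of periodic expansions *)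

Lemma cvg0_geometric_period (R : realType) (r : nat -> R) (l : nat) (mu : R) :
  (0 < l)%N -> `|mu| < 1 -> (forall k, r (k + l)%N = mu * r k) ->
  r k @[k --> \oo] --> 0.
Proof.
move=> l_gt0 mu_lt1 rS.
have rE a b : r (b + a * l)%N = mu ^+ a * r b.
  elim: a => [|a IHa]; first by rewrite mul0n addn0 mul1r.
  by rewrite mulSn addnCA addnC rS IHa exprS mulrA.
(* [B] bounds [|r|] on the first period, and the summand 1 makes it positive, so [e / B] is a valid
   tolerance for [mu ^+ a]. *)
pose B := 1 + \sum_(i < l) `|r i|.
have B_gt0 : 0 < B by rewrite ltr_pwDl // sumr_ge0.
apply/cvgr0Pnorm_lt => e e_gt0.
have /cvgr0Pnorm_lt /(_ (e / B)) := cvg_expr mu_lt1.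
case=> [|N _ HN]; first exact: divr_gt0.
exists (N * l)%N => // k /= le_k.
have {le_k}le_k : (N <= k %/ l)%N by rewrite leq_divRL.
have rB : `|r (k %% l)%N| <= B.
  rewrite /B (bigD1 (Ordinal (ltn_pmod k l_gt0))) //=.
  by rewrite addrCA lerDl addr_ge0 // sumr_ge0.
have := HN _ le_k; rewrite /= ltr_pdivlMr // => lt_e.
rewrite (divn_eq k l) addnC rE normrM.
exact: le_lt_trans (ler_wpM2l _ rB) lt_e.
Qed.

(** The recurrence has order two, so two initial checks propagate to all [k]. The coefficients [c 0]
    and [c 1] only enter the initial values, hence periodicity is asked from index 2 on. As
    [|q_k| >= 1], the error [|x - p_k / q_k|] is at most [|p_k - x q_k|]. *)
Lemma cf_value_of_contraction (R : realType) (c : nat -> R) (x mu : R) (l : nat) :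
  (0 < l)%N -> `|mu| < 1 -> (forall k, 1 <= `|cf_q c k|) ->
  (forall k, c (k + l).+2 = c k.+2) ->
  cf_p c l - x * cf_q c l = mu * (cf_p c 0 - x * cf_q c 0) ->
  cf_p c l.+1 - x * cf_q c l.+1 = mu * (cf_p c 1 - x * cf_q c 1) ->
  cf_value c x.
Proof.
move=> l_gt0 mu_lt1 q_ge1 c_per r0 r1.
have q_neq0 k : cf_q c k != 0 by rewrite -normr_gt0 (lt_le_trans ltr01).
split; first by near=> k.
have r_per k : cf_p c (k + l) - x * cf_q c (k + l) = mu * (cf_p c k - x * cf_q c k).
  suff: cf_p c (k + l) - x * cf_q c (k + l) = mu * (cf_p c k - x * cf_q c k) /\
        cf_p c (k.+1 + l) - x * cf_q c (k.+1 + l)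
        = mu * (cf_p c k.+1 - x * cf_q c k.+1) by case.
  elim: k => [//|k [IH0 IH1]]; split=> //.
  move: IH0 IH1; rewrite !addSn !cf_pSS !cf_qSS c_per => IH0 IH1.
  transitivity ((cf_p c (k + l).+1 - x * cf_q c (k + l).+1) * c k.+2
    + (cf_p c (k + l) - x * cf_q c (k + l))); first by ring.
  by rewrite IH0 IH1; ring.
have /cvgr0Pnorm_lt r_cvg := cvg0_geometric_period l_gt0 mu_lt1 r_per.
apply/cvgrPdist_lt => e e_gt0; near=> k.
have -> : x - cf_p c k / cf_q c k = - (cf_p c k - x * cf_q c k) / cf_q c k.
  by field.
rewrite normrM normrN normfV; apply: (@le_lt_trans _ _ `|cf_p c k - x * cf_q c k|).
  by rewrite ler_pdivrMr ?normr_gt0 // ler_peMr.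
by near: k; exact: r_cvg.
Unshelve. all: by end_near. Qed.

(** Signs of the partial quotients are free here. The induction also carries that [|q_k|] is
    nondecreasing, for then [|q_(k+2)| >= 2 |q_(k+1)| - |q_k| >= |q_(k+1)|]. *)
Lemma cf_q_norm_ge1 (R : realType) (c : nat -> R) :
  (forall k, 2 <= `|c k.+1|) -> forall k, 1 <= `|cf_q c k|.
Proof.
move=> c_ge2 k.
suff: 1 <= `|cf_q c k| /\ `|cf_q c k| <= `|cf_q c k.+1| by case.
elim: k => [|k [q_ge1 q_le]].
  by rewrite cf_q0 cf_q1 normr1; split=> //; have := c_ge2 0%N; lra.
split; first exact: le_trans q_le.
have := lerB_normD (cf_q c k.+1 * c k.+2) (cf_q c k).
rewrite -cf_qSS normrM.
have := c_ge2 k.+1; nra.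
Qed.

(** This criterion serves the second expansion, where partial quotients can be small or even 0:
    nonnegativity gives [q_(k+2) >= q_k]. *)
Lemma cf_q_ge1 (R : realType) (c : nat -> R) :
  1 <= c 1%N -> (forall k, 0 <= c k) -> forall k, 1 <= cf_q c k.
Proof.
move=> c1 c_ge0 k; suff: 1 <= cf_q c k /\ 1 <= cf_q c k.+1 by case.
elim: k => [|k [q0 q1]]; first by rewrite cf_q0 cf_q1.
split=> //; rewrite cf_qSS; have := c_ge0 k.+2; nra.
Qed.

(** * Trigonometric form of [Xcos] and [eta_] *)

Lemma sin_dirichlet (R : realType) (b : R) (N : nat) :
  sin b * (1 + \sum_(1 <= k < N.+1) 2 * cos (k%:R * (2 * b)))
  = sin ((2 * N + 1)%:R * b).
Proof.
elim: N => [|N IHN]; first by rewrite big_geq // addr0 mulr1 mul1r.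
rewrite big_nat_recr //= addrA mulrDr {}IHN.
(* With [a = N.+1%:R * (2 * b)], the new term is [2 sin b cos a = sin (a + b) - sin (a - b)], so the
   sum telescopes. *)
have -> : (2 * N + 1)%:R * b = N.+1%:R * (2 * b) - b.
  by rewrite natrD natrM -natr1; ring.
have -> : (2 * N.+1 + 1)%:R * b = N.+1%:R * (2 * b) + b.
  by rewrite natrD natrM -natr1; ring.
by rewrite sinB sinD; ring.
Qed.

(** Half the angle of [Xcos R m], hence the full angle of [Xcos R m.+1]; its cotangent is
    [eta_ R m]. *)
Definition theta (R : realType) (m : nat) : R := pi / 2 ^+ (m + 2).

Lemma thetaS (R : realType) (m : nat) : theta R m = 2 * theta R m.+1.
Proof. by rewrite /theta addSn exprS; field; rewrite expf_neq0. Qed.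

Lemma Xcos_theta (R : realType) (m : nat) : Xcos R m = 2 * cos (2 * theta R m).
Proof. by rewrite /Xcos /theta mulrA. Qed.

Lemma XcosS_theta (R : realType) (m : nat) : Xcos R m.+1 = 2 * cos (theta R m).
Proof. by rewrite Xcos_theta -thetaS. Qed.

Lemma theta_bounds (R : realType) (m : nat) : 0 < theta R m <= pi / 4.
Proof.
elim: m => [|m /andP[]]; last by rewrite thetaS => h0 h1; apply/andP; split; lra.
by rewrite /theta add0n expr2 -natrM; have := pi_gt0 R; move=> h; apply/andP; split; lra.
Qed.

Lemma cos_mul2 (R : realType) (a : R) : cos (2 * a) = 2 * cos a ^+ 2 - 1.
Proof. by rewrite mulr_natl cos_mulr2n mulr_natl. Qed.

Lemma sin_mul2 (R : realType) (a : R) : sin (2 * a) = 2 * sin a * cos a.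
Proof. by rewrite mulr_natl sin_mulr2n -mulr_natl; ring. Qed.

Lemma sin_theta_gt0 (R : realType) (m : nat) : 0 < sin (theta R m).
Proof.
have /andP[h0 h1] := theta_bounds R m; have h := pi_gt0 R.
by apply: sin_gt0_pihalf; apply/andP; split; lra.
Qed.

Lemma cos_theta_gt0 (R : realType) (m : nat) : 0 < cos (theta R m).
Proof.
have /andP[h0 h1] := theta_bounds R m; have h := pi_gt0 R.
by apply: cos_gt0_pihalf; apply/andP; split; lra.
Qed.

Lemma Xcos_ge0 (R : realType) (m : nat) : 0 <= Xcos R m.
Proof.
have /andP[h0 h1] := theta_bounds R m; have h := pi_gt0 R.
rewrite Xcos_theta mulr_ge0 //.
by apply: cos_ge0_pihalf; apply/andP; split; lra.
Qed.

(** The double angle has nonnegative cosine, so [cos ^+ 2 >= sin ^+ 2]. In terms of [eta_] this is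
    [eta_ R m >= 1]. *)
Lemma sin_le_cos_theta (R : realType) (m : nat) : sin (theta R m) <= cos (theta R m).
Proof.
have := Xcos_ge0 R m; rewrite Xcos_theta cos_mul2.
have := cos2Dsin2 (theta R m); have := sin_theta_gt0 R m; have := cos_theta_gt0 R m.
nra.
Qed.

Lemma cos_theta_lt1 (R : realType) (m : nat) : cos (theta R m) < 1.
Proof.
have := cos2Dsin2 (theta R m); have := sin_theta_gt0 R m; have := cos_theta_gt0 R m.
nra.
Qed.

Lemma Xcos_lt2 (R : realType) (m : nat) : Xcos R m < 2.
Proof.
rewrite Xcos_theta cos_mul2.
have := cos_theta_lt1 R m; have := cos_theta_gt0 R m; nra.
Qed.

Lemma Xcos0 (R : realType) : Xcos R 0 = 0.
Proof.
rewrite /Xcos add0n expr2.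
have -> : 2 * pi / (2 * 2) = pi / 2 :> R by field.
by rewrite cos_pihalf mulr0.
Qed.

Lemma Xcos_sqr (R : realType) (m : nat) : Xcos R m.+1 ^+ 2 = 2 + Xcos R m.
Proof. by rewrite XcosS_theta Xcos_theta cos_mul2; ring. Qed.

Lemma eta_cot (R : realType) (m : nat) :
  eta_ R m = cos (theta R m) / sin (theta R m).
Proof.
have s0 := lt0r_neq0 (sin_theta_gt0 R m).
apply: (mulfI s0); rewrite mulrCA mulfV // mulr1.
have p_gt0 : (0 < 2 ^ m)%N by rewrite expn_gt0.
have := sin_dirichlet (theta R m) (2 ^ m).-1; rewrite prednK // => E.
have -> : cos (theta R m) = sin ((2 * (2 ^ m).-1 + 1)%:R * theta R m).
  (* The sum stops at [2 ^ m - 1], so the multiplier is [2 ^ (m + 1) - 1], while [2 ^ (m + 1)] times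
     [theta R m] is [pi / 2]. *)
  have -> : (2 * (2 ^ m).-1 + 1)%:R * theta R m = pi / 2 - theta R m.
    have : (2 ^ m).-1%:R + 1 = 2 ^+ m :> R by rewrite natr1 prednK // natrX.
    rewrite natrD natrM => /(canRL (addrK _)) ->.
    by rewrite /theta exprD; field; rewrite expf_neq0.
  by rewrite sinB cos_pihalf sin_pihalf; ring.
rewrite -E /eta_; congr (_ * (1 + _)); apply: eq_bigr => k _.
by congr (_ * cos _); rewrite /theta !exprD; field; rewrite expf_neq0.
Qed.

Lemma eta0 (R : realType) : eta_ R 0 = 1.
Proof. by rewrite /eta_ big_geq // addr0. Qed.

(** The half-angle formula for the cotangent; subtracting [cot] leaves
    [eta_(m+1) - eta_m = 1 / sin (theta R m)]. *)
Lemma etaS_half_angle (R : realType) (m : nat) :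
  eta_ R m.+1 = (1 + cos (theta R m)) / sin (theta R m).
Proof.
rewrite eta_cot (thetaS R m) cos_mul2 sin_mul2.
have := lt0r_neq0 (sin_theta_gt0 R m.+1); have := lt0r_neq0 (cos_theta_gt0 R m.+1).
by move=> ? ?; field; do ?[apply/andP; split].
Qed.

Lemma etaS_inv (R : realType) (m : nat) :
  (eta_ R m.+1)^-1 = eta_ R m.+1 - 2 * eta_ R m.
Proof.
rewrite !eta_cot (thetaS R m) cos_mul2 sin_mul2.
have hs := lt0r_neq0 (sin_theta_gt0 R m.+1).
have hc := lt0r_neq0 (cos_theta_gt0 R m.+1).
have := cos2Dsin2 (theta R m.+1).
move: (cos _) (sin _) hc hs => u v u0 v0 uv.
have -> : 2 * u ^+ 2 - 1 = u ^+ 2 - v ^+ 2 by lra.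
by field; rewrite u0 v0.
Qed.

(** * Integrality over the ring generated by [Xcos R m] *)

Section IntAdjoin.
Variables (R : realType) (x : R).

Lemma int_adjoin_int (a : int) : int_adjoin x a%:~R.
Proof. by exists a%:P; rewrite map_polyC hornerC. Qed.

Lemma int_adjoin_nat (a : nat) : int_adjoin x a%:R.
Proof. exact: (int_adjoin_int a). Qed.

Lemma int_adjoin_gen : int_adjoin x x.
Proof. by exists 'X; rewrite map_polyX hornerX. Qed.

Lemma int_adjoinD (a b : R) : int_adjoin x a -> int_adjoin x b -> int_adjoin x (a + b).
Proof. by move=> [f ->] [g ->]; exists (f + g); rewrite rmorphD hornerD. Qed.

Lemma int_adjoinB (a b : R) : int_adjoin x a -> int_adjoin x b -> int_adjoin x (a - b).
Proof. by move=> [f ->] [g ->]; exists (f - g); rewrite rmorphB hornerD hornerN. Qed.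

Lemma int_adjoinM (a b : R) : int_adjoin x a -> int_adjoin x b -> int_adjoin x (a * b).
Proof. by move=> [f ->] [g ->]; exists (f * g); rewrite rmorphM hornerM. Qed.

Lemma int_adjoin_trans (y z : R) : int_adjoin x y -> int_adjoin y z -> int_adjoin x z.
Proof. by move=> [f ->] [g ->]; exists (g \Po f); rewrite map_comp_poly horner_comp. Qed.

End IntAdjoin.

(** Chebyshev recurrence: [2 cos ((k+2) a)] is [2 cos a] times [2 cos ((k+1) a)] minus
    [2 cos (k a)]. *)
Lemma int_adjoin_cos_mul (R : realType) (a : R) (k : nat) :
  int_adjoin (2 * cos a) (2 * cos (k%:R * a)).
Proof.
suff: int_adjoin (2 * cos a) (2 * cos (k%:R * a)) /\
      int_adjoin (2 * cos a) (2 * cos (k.+1%:R * a)) by case.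
elim: k => [|k [IH0 IH1]].
  rewrite mul0r cos0 mulr1 mul1r; split; first exact: int_adjoin_nat.
  exact: int_adjoin_gen.
split=> //.
have -> : 2 * cos (k.+2%:R * a)
    = 2 * cos a * (2 * cos (k.+1%:R * a)) - 2 * cos (k%:R * a).
  have -> : k.+2%:R * a = k.+1%:R * a + a by rewrite -natr1; ring.
  have -> : k%:R * a = k.+1%:R * a - a by rewrite -natr1; ring.
  by rewrite cosD cosB; ring.
by apply: int_adjoinB => //; apply: int_adjoinM => //; exact: int_adjoin_gen.
Qed.

Lemma int_adjoin_eta (R : realType) (m : nat) : int_adjoin (Xcos R m) (eta_ R m).
Proof.
apply: int_adjoinD; first exact: (int_adjoin_nat _ 1).
apply: (big_ind (int_adjoin (Xcos R m))) => [|a b|k _].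
- exact: (int_adjoin_nat _ 0).
- exact: int_adjoinD.
- have -> : k%:R * pi / 2 ^+ (m + 1) = k%:R * (2 * theta R m).
    by rewrite /theta !exprD; field; rewrite expf_neq0.
  by rewrite Xcos_theta; exact: int_adjoin_cos_mul.
Qed.

Lemma int_adjoin_XcosS (R : realType) (m : nat) (y : R) :
  int_adjoin (Xcos R m) y -> int_adjoin (Xcos R m.+1) y.
Proof.
apply: int_adjoin_trans.
have -> : Xcos R m = Xcos R m.+1 * Xcos R m.+1 - 2.
  by rewrite -expr2 Xcos_sqr; ring.
apply: int_adjoinB; last exact: int_adjoin_nat.
by apply: int_adjoinM; exact: int_adjoin_gen.
Qed.

Lemma int_adjoin_eta_inv (R : realType) (m : nat) :
  int_adjoin (Xcos R m) (eta_ R m)^-1.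
Proof.
case: m => [|m]; first by rewrite eta0 invr1; exact: (int_adjoin_nat _ 1).
rewrite etaS_inv; apply: int_adjoinB; first exact: int_adjoin_eta.
apply: int_adjoinM; first exact: int_adjoin_nat.
by apply: int_adjoin_XcosS; exact: int_adjoin_eta.
Qed.

Lemma int_adjoin_div_2BXcos (R : realType) (m : nat) :
  int_adjoin (Xcos R m) (2 / (2 - Xcos R m)).
Proof.
elim: m => [|m IHm].
  by rewrite Xcos0 subr0 mulfV //; exact: (int_adjoin_nat _ 1).
have -> : 2 / (2 - Xcos R m.+1) = (2 + Xcos R m.+1) * (2 / (2 - Xcos R m)).
  have -> : Xcos R m = Xcos R m.+1 ^+ 2 - 2 by rewrite Xcos_sqr; ring.
  have h0 := Xcos_ge0 R m.+1; have h2 := Xcos_lt2 R m.+1.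
  by field; apply/andP; split; apply: lt0r_neq0; nra.
apply: int_adjoinM; last exact: int_adjoin_XcosS.
by apply: int_adjoinD; [exact: int_adjoin_nat | exact: int_adjoin_gen].
Qed.

(** Multiplying through by [2 - Xcos R m.+1] reduces this to the previous lemma one level down,
    without a new induction. *)
Lemma int_adjoin_div_2DXcos (R : realType) (m : nat) :
  int_adjoin (Xcos R m) (2 / (2 + Xcos R m)).
Proof.
case: m => [|m].
  by rewrite Xcos0 addr0 mulfV //; exact: (int_adjoin_nat _ 1).
have -> : 2 / (2 + Xcos R m.+1) = (2 - Xcos R m.+1) * (2 / (2 - Xcos R m)).
  have -> : Xcos R m = Xcos R m.+1 ^+ 2 - 2 by rewrite Xcos_sqr; ring.
  have h0 := Xcos_ge0 R m.+1; have h2 := Xcos_lt2 R m.+1.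
  by field; apply/andP; split; apply: lt0r_neq0; nra.
apply: int_adjoinM; last exact/int_adjoin_XcosS/int_adjoin_div_2BXcos.
by apply: int_adjoinB; [exact: int_adjoin_nat | exact: int_adjoin_gen].
Qed.

(** * The two periodic expansions of [Xcos R m.+1] *)

Lemma ev_periodic_ind (R : realType) (P : R -> Prop) (s t : seq R) :
  (0 < size t)%N -> (forall y, y \in s -> P y) -> (forall y, y \in t -> P y) ->
  forall k, P (ev_periodic s t k).
Proof.
move=> t_gt0 Ps Pt k; rewrite /ev_periodic; case: ifP => [k_lt|_].
- exact/Ps/mem_nth.
- by apply/Pt/mem_nth; rewrite ltn_mod.
Qed.

Lemma ev_periodicD (R : realType) (s t : seq R) (k : nat) :
  (size s <= k)%N -> ev_periodic s t (k + size t) = ev_periodic s t k.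
Proof.
move=> le_k; rewrite /ev_periodic ltnNge (leq_trans le_k) ?leq_addr //=.
by rewrite ltnNge le_k /= -addnBAC // modnDr.
Qed.

Lemma cf_value_Xcos_period2 (R : realType) (m : nat) :
  cf_value (ev_periodic [:: 2] [:: 4 / (Xcos R m - 2); 4]) (Xcos R m.+1).
Proof.
have x0 := Xcos_ge0 R m.+1; have x2 := Xcos_lt2 R m.+1.
have y0 := Xcos_ge0 R m; have y2 := Xcos_lt2 R m.
have xy := Xcos_sqr R m.
set c := ev_periodic _ _; set x := Xcos R m.+1 in x0 x2 xy *.
have x_gt0 : 0 < x by nra.
have x2n0 : x + 2 != 0 by apply: lt0r_neq0; lra.
have xy0 : Xcos R m - 2 != 0 by apply: ltr0_neq0; lra.
(* The multiplier is read off from [r_0 = 2 - x] and [r_2 = - (x - 2) ^+ 2 / (x + 2)], where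
   [r_k = p_k - x q_k]. *)
apply: (@cf_value_of_contraction _ _ _ ((x - 2) / (x + 2)) 2) => //.
- by rewrite normrM normfV ltr_pdivrMr ?normr_gt0 // ltr0_norm ?ger0_norm; lra.
(* The quotient [4 / (Xcos R m - 2)] is negative, at most -2 because [0 <= Xcos R m < 2]; this calls
   for the bound on norms. *)
- apply: cf_q_norm_ge1 => k.
  have -> : c k.+1 = if odd k then 4 else 4 / (Xcos R m - 2).
    by rewrite /c /ev_periodic /= subSS subn0 modn2; case: odd.
  case: ifP => _; first by rewrite ger0_norm //; lra.
  rewrite normrM normfV (ltr0_norm (x := _ - _)); last by lra.
  by rewrite ger0_norm // ler_pdivlMr; lra.
- by move=> k; exact: (@ev_periodicD _ [:: 2] [:: _; _] k.+2).
all: have E : Xcos R m = x ^+ 2 - 2 by lra.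
all: rewrite !cf_pSS !cf_qSS cf_p1 cf_q1 cf_p0 cf_q0 /c /ev_periodic /= E.
all: by rewrite E in xy0; field; rewrite x2n0 xy0.
Qed.

Lemma cf_value_Xcos_period3 (R : realType) (m : nat) :
  cf_value (ev_periodic [::] [:: 2 - (eta_ R m)^-1; eta_ R m;
                                 2 / (2 + Xcos R m) - (eta_ R m)^-1])
    (Xcos R m.+1).
Proof.
rewrite XcosS_theta Xcos_theta cos_mul2 eta_cot.
have := cos_theta_gt0 R m; have := sin_theta_gt0 R m; have := sin_le_cos_theta R m.
have := cos_theta_lt1 R m; have := cos2Dsin2 (theta R m).
move: (cos _) (sin _) => u v uv u_lt1 le_vu v_gt0 u_gt0.
have u0 := lt0r_neq0 u_gt0; have v0 := lt0r_neq0 v_gt0.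
have -> : 2 / (2 + 2 * (2 * u ^+ 2 - 1)) = (2 * u ^+ 2)^-1.
  have -> : 2 + 2 * (2 * u ^+ 2 - 1) = 4 * u ^+ 2 by ring.
  by field.
set c := ev_periodic _ _.
have u1 : 1 + u != 0 by apply: lt0r_neq0; lra.
have vE2 : v ^+ 2 = (1 - u) * (1 + u) by rewrite -[LHS](addKr (u ^+ 2)) uv; ring.
(* The numerator of [1 + t ^+ 2] below, left unsimplified in the shape of the side condition of
   [field]. *)
have u2 : 1 + u + (1 - u) != 0 by apply: lt0r_neq0; lra.
(* The tangent half-angle parametrization of the circle leaves only rational
   identities in [t]. *)
pose t := v / (1 + u).
have t2 : t ^+ 2 = (1 - u) / (1 + u) by rewrite expr_div_n vE2; field.
have tn0 : 1 + t ^+ 2 != 0 by apply: lt0r_neq0; rewrite ltr_pwDl ?sqr_ge0.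
have uE : u = (1 - t ^+ 2) / (1 + t ^+ 2).
  by rewrite t2; field; rewrite u1 u2.
have vE : v = 2 * t / (1 + t ^+ 2).
  by rewrite t2 /t; field; rewrite u1 u2.
(* The multiplier is [- t], minus the tangent of half of [theta R m], that is [- 1 / eta_(m+1)]. *)
apply: (@cf_value_of_contraction _ _ _ ((u - 1) / v) 3) => //.
- by rewrite normrM normfV ltr_pdivrMr ?normr_gt0 // ltr0_norm ?gtr0_norm; nra.
- have c_ge0 : forall k, 0 <= c k.
    apply: (@ev_periodic_ind _ (fun y => 0 <= y)) => // y.
    rewrite !inE => /or3P[]/eqP-> {y}.
    + have : v / u <= 1 by rewrite ler_pdivrMr // mul1r.
      by rewrite invf_div; lra.
    + by rewrite divr_ge0 ?ltW.
    (* Writing 1 as [u ^+ 2 + v ^+ 2] turns the third quotient into half a square. It vanishes for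
       [m = 0], where [u = v]. *)
    + have -> : (2 * u ^+ 2)^-1 - (u / v)^-1 = (1 - v / u) ^+ 2 / 2.
        have -> : (2 * u ^+ 2)^-1 = (u ^+ 2 + v ^+ 2) / (2 * u ^+ 2).
          by rewrite uv div1r.
        by field; rewrite u0 v0.
      by rewrite divr_ge0 ?sqr_ge0.
  have q_ge1 k : 1 <= cf_q c k.
    by apply: cf_q_ge1 => //; rewrite /c /ev_periodic /= ler_pdivlMr // mul1r.
  by move=> k; rewrite ger0_norm // (le_trans ler01).
- by move=> k; exact: (@ev_periodicD _ [::] [:: _; _; _] k.+2).
all: rewrite !cf_pSS !cf_qSS cf_p1 cf_q1 cf_p0 cf_q0 /c /ev_periodic /=.
all: have t0 : t != 0 by rewrite mulf_neq0 ?invr_eq0.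
all: have t1 : 1 - t ^+ 2 != 0 by apply: contraNneq u0; rewrite uE => ->; rewrite mul0r.
all: by rewrite uE vE; field; rewrite ?t0 ?t1 ?tn0.
Qed.

Theorem theorem4p2 (R : realType) (n : nat) (n_ge1 : (1 <= n)%N) :
  let X := Xcos R in
  let eta := eta_ R in
  let c := ev_periodic [:: 2] [:: 4 / (X n.-1 - 2); 4] in
  let d := ev_periodic [::]
    [:: ((eta n - eta n.-1) * X n - 1) / eta n.-1;
        eta n.-1;
        ((eta n - eta n.-1) / X n - 1) / eta n.-1] in
  [/\ cf_value c (X n),
      cf_value d (X n),
      forall k, int_adjoin (X n.-1) (c k)
    & forall k, int_adjoin (X n.-1) (d k)].
Proof.
case: n n_ge1 => // m _ X eta c d.
(* The factor -2 is written [0 - 2] to use closure under subtraction. *)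
have cE : 4 / (X m - 2) = (0 - 2) * (2 / (2 - X m)).
  have h := Xcos_lt2 R m.
  have ? : X m - 2 != 0 by apply: ltr0_neq0; rewrite /X; lra.
  have ? : 2 - X m != 0 by apply: lt0r_neq0; rewrite /X; lra.
  by field; apply/andP; split.
(* Since [eta_(m+1) - eta_m = 1 / sin] and [X_(m+1) = 2 cos], the product
   [(eta_(m+1) - eta_m) X_(m+1)] is [2 eta_m], and the quotient divided by [eta_m] is
   [1 / (2 cos ^+ 2) = 2 / (2 + X_m)]. Integrality is visible in this form. *)
have dE : d = ev_periodic [::] [:: 2 - (eta m)^-1; eta m; 2 / (2 + X m) - (eta m)^-1].
  have s0 := lt0r_neq0 (sin_theta_gt0 R m); have c0 := lt0r_neq0 (cos_theta_gt0 R m).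
  have X2 : 2 + Xcos R m = 4 * cos (theta R m) ^+ 2.
    by rewrite Xcos_theta cos_mul2; ring.
  rewrite /d /X /eta X2 XcosS_theta etaS_half_angle eta_cot /=.
  congr (ev_periodic [::] [:: _; _; _]); by field; rewrite ?s0 ?c0.
split.
- exact: cf_value_Xcos_period2.
- rewrite dE; exact: cf_value_Xcos_period3.
- apply: ev_periodic_ind => // y; rewrite !inE; [move=> /eqP-> | case/orP=> /eqP->].
  + exact: int_adjoin_nat.
  + rewrite cE; apply: int_adjoinM; last exact: int_adjoin_div_2BXcos.
    by apply: int_adjoinB; [exact: (int_adjoin_nat _ 0) | exact: int_adjoin_nat].
  + exact: int_adjoin_nat.
- rewrite dE; apply: ev_periodic_ind => // y; rewrite !inE => /or3P[]/eqP->.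
  + by apply: int_adjoinB; [exact: int_adjoin_nat | exact: int_adjoin_eta_inv].
  + exact: int_adjoin_eta.
  + by apply: int_adjoinB; [exact: int_adjoin_div_2DXcos | exact: int_adjoin_eta_inv].
Qed.
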